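(* Let $S$ be an infinite set and let $A\in(\mathbb{R}\cup\{-\infty\})^{S\times S}$ be such that $\rho(A)\in\mathbb{R}$. Assume that $A$ is irreducible, that $\tilde A$ has Property (T), and that $N^c(A)\neq\emptyset$. Then, for all $i,j\in S$, there exist $\sigma_{ij}\in\mathbb{N}\setminus\{0\}$ and $n_{ij}\in\mathbb{N}$ such that $$(A^{n+\sigma_{ij}})_{ij}=\sigma_{ij}\,\rho(A)+(A^n)_{ij}\qquad\text{for all } n\ge n_{ij},$$ and the following explicit formula holds: $$(\tilde A^{n})_{ij}=\sup_{k\in N^c(A)}\Big[\big(\tilde A^{q}(\tilde A^{\sigma_{ij}})^*\big)_{ik}+\big(\tilde A^{q'}(\tilde A^{\sigma_{ij}})^*\big)_{kj}\Big]\qquad\text{for all } n\ge n_{ij},$$ where $q,q'$ are arbitrary numbers in $\{0,\dots,\sigma_{ij}-1\}$ such that $q+q'\equiv n \pmod{\sigma_{ij}}$. Furthermore, when $\sigma(A)$ is finite, the integer $\sigma_{ij}$ can be chosen so that it divides $\sigma(A)$.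
   Context: Write $\overline{\mathbb{R}}=\mathbb{R}\cup\{-\infty,+\infty\}$, with the convention $(-\infty)+(+\infty)=-\infty$; the supremum of the empty set is $-\infty$; $\mathbb{N}=\{0,1,2,\dots\}$. For $B,C\in\overline{\mathbb{R}}^{S\times S}$ the (max-plus) product is $(BC)_{ij}=\sup_{k\in S}(B_{ik}+C_{kj})$; all matrix products and powers are in this sense; $B^0=I$ is the matrix with $0$ on the diagonal and $-\infty$ elsewhere, and $B^*_{ij}:=\sup_{n\ge0}(B^n)_{ij}$. $G(A)$ is the digraph with node set $S$ and an arc $i\to j$ whenever $A_{ij}\ne-\infty$; $A$ is irreducible if $G(A)$ is strongly connected. A path $p=(i_0,\dots,i_n)$ in $G(A)$ has length $|p|=n$ and weight $|p|_A=\sum_{t=0}^{n-1}A_{i_ti_{t+1}}$; a circuit is a path of length $\ge1$ with $i_0=i_n$. The maximal circuit mean is $\rho(A):=\sup_{c}|c|_A/|c|$ over all circuits $c$ of $G(A)$. When $\rho(A)\in\mathbb{R}$, $\tilde A_{ij}:=A_{ij}-\rho(A)$. The critical graph $G^c(A)$ is the subgraph of $G(A)$ which is the union (nodes and arcs) of all circuits $c$ with $|c|_A/|c|=\rho(A)$; its set of nodes is denoted $N^c(A)$ (critical nodes). The cyclicity of a strongly connected (possibly infinite) graph is the gcd of the lengths of its circuits. The cyclicity of a non strongly connected graph is the lcm of the cyclicities of its strongly connected components (possibly infinite if there are infinitely many components). $\sigma(A)$ denotes the cyclicity of the critical graph $G^c(A)$. A map $v:S\to\overline{\mathbb{R}}$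 is tight if $v_j\neq+\infty$ for all $j$ and $\{j\in S: v_j\ge\beta\}$ is finite for every $\beta\in\mathbb{R}$. A vector $u\in\overline{\mathbb{R}}^S$ is $B$-tight if for each $i\in S$ the map $j\mapsto B_{ij}+u_j$ is tight. A matrix $B$ has Property (T) if all columns of $B^*$ are $B^*$-tight, i.e. for all $i,j\in S$ the map $k\mapsto B^*_{ik}+B^*_{kj}$ is tight. *)

(* Defs.v *)
From HB Require Import structures.
From mathcomp Require Import all_boot all_order all_algebra.
From mathcomp Require Import all_classical all_reals.
From mathcomp Require Import ereal.
Set Implicit Arguments.
Unset Strict Implicit.
Unset Printing Implicit Defensive.
Import Order.TTheory GRing.Theory Num.Theory.

Local Open Scope classical_set_scope.

(* gcd and lcm of an arbitrary, possibly infinite, set of naturals. *)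

Definition is_gcd (D : set nat) (g : nat) : Prop :=
  (forall d, D d -> g %| d) /\ (forall m, (forall d, D d -> m %| d) -> m %| g).

Definition is_lcm (D : set nat) (m : nat) : Prop :=
  (forall d, D d -> d %| m) /\ (forall n, (forall d, D d -> d %| n) -> m %| n).

Definition gcd_set (D : set nat) : nat := xget 0 (is_gcd D).

(* [None] stands for an infinite lcm, i.e. no positive common multiple. *)
Definition lcm_set (D : set nat) : option nat :=
  xget None [set Some m | m in [set m | 0 < m /\ is_lcm D m]].

Lemma gcd_setP (D : set nat) : is_gcd D (gcd_set D).
Proof.
apply: xgetPex.
have [D0|] := pselect (D `<=` [set 0]).
  by exists 0; split=> [d /D0 ->|m _]; rewrite dvdn0.
move=> /existsNP[d0 /not_implyP[Dd0 /eqP d0_neq0]].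
pose P m := `[< forall d, D d -> m %| d >].
have exP : exists m, P m by exists 1; apply/asboolP => d _; rewrite dvd1n.
have leP m : P m -> m <= d0.
  by move=> /asboolP /(_ _ Dd0) /dvdn_leq; apply; rewrite lt0n.
case: (ex_maxnP exP leP) => g /asboolP gD gmax; exists g; split=> // m mD.
have Plcm : P (lcmn m g) by apply/asboolP => d Dd; rewrite dvdn_lcm mD// gD.
have lcm_gt0 : 0 < lcmn m g.
  rewrite lt0n; apply: contra d0_neq0 => /eqP lcm0.
  by rewrite -dvd0n -lcm0; move/asboolP: Plcm; apply.
have -> : g = lcmn m g.
  by apply/eqP; rewrite eqn_leq gmax// andbT dvdn_leq// dvdn_lcmr.
exact: dvdn_lcml.
Qed.

Lemma lcm_set_someP (D : set nat) (m : nat) :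
  lcm_set D = Some m <-> 0 < m /\ is_lcm D m.
Proof.
rewrite /lcm_set; split=> [|[m0 mD]].
  by case: xgetP => [_ -> [n nD <-] [<-]|].
apply: (@xget_unique _ None [set Some n | n in _]); first by exists m.
move=> _ [n [_ nD] <-]; congr Some; apply/eqP.
by rewrite eqn_dvd (proj2 nD _ (proj1 mD)) (proj2 mD _ (proj1 nD)).
Qed.

Lemma lcm_set_noneP (D : set nat) :
  lcm_set D = None <-> forall m, 0 < m -> ~ (forall d, D d -> d %| m).
Proof.
split=> [DN m m0 mD|DN].
  pose P n := (0 < n) && `[< forall d, D d -> d %| n >].
  have exP : exists n, P n by exists m; rewrite /P m0; apply/asboolP.
  case: (ex_minnP exP) => l /andP[l0 /asboolP lD] lmin.
  have : lcm_set D = Some l.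
    apply/lcm_set_someP; split=> //; split=> // n nD.
    have -> : l = gcdn l n; last exact: dvdn_gcdr.
    apply/eqP; rewrite eqn_leq (@dvdn_leq (gcdn l n) l) ?dvdn_gcdl// andbT.
    apply: lmin; rewrite /P gcdn_gt0 l0 /=; apply/asboolP => d Dd.
    by rewrite dvdn_gcd lD// nD.
  by rewrite DN.
case E : (lcm_set D) => [m|//].
by move/lcm_set_someP: E => [m0 [mD _]]; case: (DN m m0).
Qed.

(* Directed graphs on a possibly infinite node set. *)

Record digraph (S : Type) := Digraph {
  node : set S;
  arc : rel S;
  arc_node : forall i j, arc i j -> node i /\ node j }.

Section Digraph.
Variable S : Type.
Implicit Types (g : digraph S) (i j x y : S) (p : seq S) (C : set S).

(* [x] and [p] encode the path (i_0, ..., i_n) with i_0 = x and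
   p = [:: i_1; ...; i_n]; its length is [size p]. *)
Definition is_path g x p : Prop := node g x /\ path (arc g) x p.

Definition is_circuit g x p : Prop :=
  [/\ is_path g x p, 0 < size p & last x p = x].

Definition node_of x p i : Prop :=
  exists2 t, t <= size p & nth x (x :: p) t = i.

Definition arc_of x p i j : Prop :=
  exists t, [/\ t < size p, nth x (x :: p) t = i & nth x p t = j].

Definition connects g x y : Prop := exists2 p, is_path g x p & last x p = y.

Definition strongly_connected g : Prop :=
  forall x y, node g x -> node g y -> connects g x y.

Definition component g x : set S := [set y | connects g x y /\ connects g y x].

Lemma induced_arc_node g C i j :
  [&& arc g i j, `[< C i >] & `[< C j >]] ->
  (node g `&` C) i /\ (node g `&` C) j.
Proof.
by move=> /and3P[gij /asboolP Ci /asboolP Cj]; have [] := arc_node gij.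
Qed.

Definition induced g C : digraph S := Digraph (@induced_arc_node g C).

Definition circuit_lengths g : set nat :=
  [set n | exists x p, is_circuit g x p /\ size p = n].

Definition sc_cyclicity g : nat := gcd_set (circuit_lengths g).

(* [None] stands for an infinite cyclicity. *)
Definition cyclicity g : option nat :=
  if `[< strongly_connected g >] then Some (sc_cyclicity g)
  else lcm_set [set sc_cyclicity (induced g (component g x)) | x in node g].

End Digraph.

Local Open Scope ereal_scope.

(* Max-plus matrices. The addition of [\bar R] satisfies -oo + +oo = -oo and
   [ereal_sup set0 = -oo]. *)

Section MaxPlus.
Variables (R : realType) (S : Type).
Implicit Types (A B C : S -> S -> \bar R) (u v : S -> \bar R).

Definition mpmul B C : S -> S -> \bar R :=
  fun i j => ereal_sup [set B i k + C k j | k in [set: S]].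

Definition mpone : S -> S -> \bar R :=
  fun i j => if `[< i = j >] then 0 else -oo.

Definition mpexp B (n : nat) : S -> S -> \bar R := iter n (mpmul B) mpone.

Definition mpstar B : S -> S -> \bar R :=
  fun i j => ereal_sup [set mpexp B n i j | n in [set: nat]].

Definition tight v : Prop :=
  (forall j, v j != +oo) /\
  (forall beta : R, finite_set [set j | beta%:E <= v j]).

Definition matrix_tight B u : Prop := forall i, tight (fun j => B i j + u j).

Definition property_T B : Prop :=
  forall j, matrix_tight (mpstar B) (fun k => mpstar B k j).

Lemma graph_arc_node A i j :
  A i j != -oo -> [set: S] i /\ [set: S] j.
Proof. by []. Qed.

Definition graph A : digraph S := Digraph (@graph_arc_node A).

Definition irreducible A : Prop := strongly_connected (graph A).

Definition weight A (x : S) (p : seq S) : \bar R :=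
  \sum_(t < size p) A (nth x (x :: p) t) (nth x p t).

Definition mean_weight A (x : S) (p : seq S) : \bar R :=
  weight A x p * ((size p)%:R^-1)%:E.

Definition rho A : \bar R :=
  ereal_sup [set r | exists x p, is_circuit (graph A) x p /\
                                 mean_weight A x p = r].

Definition normalized A : S -> S -> \bar R := fun i j => A i j - rho A.

Definition critical_circuit A (x : S) (p : seq S) : Prop :=
  is_circuit (graph A) x p /\ mean_weight A x p = rho A.

Definition critical_nodes A : set S :=
  [set i | exists x p, critical_circuit A x p /\ node_of x p i].

Definition critical_arc A : rel S :=
  fun i j => `[< exists x p, critical_circuit A x p /\ arc_of x p i j >].

Lemma critical_arc_node A i j :
  critical_arc A i j -> critical_nodes A i /\ critical_nodes A j.
Proof.
move=> /asboolP[x [p [cp [t [tp ti tj]]]]]; split; exists x, p; split=> //.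
  by exists t => //; exact: ltnW.
by exists t.+1.
Qed.

Definition critical_graph A : digraph S := Digraph (@critical_arc_node A).

Definition sigma A : option nat := cyclicity (critical_graph A).

End MaxPlus.

Arguments mpone {R S}.

(* Main.v *)
(* Write B for the normalized matrix. Property (T) confines all walks from i to j
   of weight at least beta to a finite set F of nodes. Through a fixed critical
   node, every residue class of lengths that contains a walk from i to j contains
   walks of all large lengths and of weight at least some fixed beta, so only
   walks inside F matter. Outside the critical nodes the circuits inside F lose a
   fixed amount of weight, hence a long walk of weight at least beta meets a
   critical node. Take sigma_ij to be the lcm of the periods of the critical nodes
   in F and of the fixed one. A pair of walks i -> k -> j with k critical can be shortened modulo
   sigma_ij by deleting closed subwalks, whose weights are nonpositive, and then
   lengthened by zero loops at k to any large length of the same residue; moving k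
   along its critical circuit redistributes the residues of the two parts. *)
Require Import Defs.
From mathcomp Require Import all_boot all_order all_algebra.
From mathcomp Require Import all_classical all_reals.
From mathcomp Require Import ereal.
From mathcomp Require Import zify lra.
Set Implicit Arguments.
Unset Strict Implicit.
Unset Printing Implicit Defensive.
Import Order.TTheory GRing.Theory Num.Theory.

Local Open Scope classical_set_scope.

(** * Finite sets and additive semigroups of naturals *)

Lemma finite_set_index (T : eqType) (F : set T) : finite_set F ->
  exists (M : nat) (e : T -> nat),
    (forall k, F k -> e k < M) /\
    (forall k l, F k -> F l -> e k = e l -> k = l).
Proof.
move=> /finite_seqP[s ->]; exists (size s), (index ^~ s).
split=> [k ks|k l ks ls]; first by rewrite index_mem.
by move=> kl; rewrite -(nth_index k ks) kl nth_index.
Qed.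

Lemma finite_set_eventually (T : eqType) (F : set T) (P : T -> nat -> Prop) :
  finite_set F ->
  (forall k, F k -> exists N, forall n, N <= n -> P k n) ->
  exists N, forall k n, F k -> N <= n -> P k n.
Proof.
move=> /finite_seqP[s ->] /=; elim: s => [_|k s IH sP]; first by exists 0.
have [l ls|N NP] := IH; first by apply: sP; rewrite inE ls orbT.
have [N' N'P] := sP k (mem_head _ _).
exists (maxn N N') => l n; rewrite inE geq_max => /orP[/eqP ->|ls] /andP[? ?].
  exact: N'P.
exact: NP.
Qed.

Lemma finite_set_lcm (T : eqType) (F : set T) (g : T -> nat) :
  finite_set F -> (forall k, F k -> 0 < g k) ->
  exists l, [/\ 0 < l, forall k, F k -> g k %| l &
                forall m, (forall k, F k -> g k %| m) -> l %| m].
Proof.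
move=> /finite_seqP[s ->] /= g0.
exists (\big[lcmn/1]_(k <- s) g k); split=> [|k ks|m mP].
- rewrite big_seq; elim/big_ind: _ => // m n m0 n0.
  by rewrite lcmn_gt0 m0.
- by rewrite (big_rem k)//= dvdn_lcml.
- rewrite big_seq; elim/big_ind: _ => // m1 m2 m1m m2m.
  by rewrite dvdn_lcm m1m.
Qed.

(* A set of naturals closed under addition contains every large multiple of
   the least positive difference [a - b] of two of its elements. *)
Lemma semigroup_gcd (D : set nat) : D 0 ->
  (forall m n, D m -> D n -> D (m + n)) -> (exists2 n, 0 < n & D n) ->
  exists g, [/\ 0 < g, forall n, D n -> g %| n &
                exists N, forall n, N <= n -> g %| n -> D n].
Proof.
move=> D0 Dadd [n0 n0_gt0 Dn0].
have Dmul q m : D m -> D (q * m).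
  by move=> Dm; elim: q => [|q IH]; rewrite ?mul0n// mulSn; exact: Dadd.
pose P d := `[< 0 < d /\ exists2 b, D b & D (b + d) >].
have exP : exists d, P d by exists n0; apply/asboolP; split=> //; exists 0.
case: (ex_minnP exP) => g /asboolP[g_gt0 [b Db Dbg]] gmin.
have gD n : D n -> g %| n.
  move=> Dn; rewrite /dvdn; apply: contraT; rewrite -lt0n => r_gt0.
  suff : g <= n %% g by rewrite leqNgt ltn_mod g_gt0.
  apply: gmin; apply/asboolP; split=> //; exists (n %/ g * (b + g)).
    exact: Dmul.
  have -> : n %/ g * (b + g) + n %% g = n %/ g * b + n.
    by rewrite mulnDr -addnA -divn_eq.
  by apply: Dadd => //; exact: Dmul.
exists g; split=> //.
have [b0|b_gt0] := posnP b.
  by exists 0 => n _ /dvdnP[q ->]; apply: Dmul; rewrite b0 in Dbg.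
have [b' b'E] : exists b', b = b' * g by apply/dvdnP; exact: gD.
have b'_gt0 : 0 < b' by move: b_gt0; rewrite b'E muln_gt0 => /andP[].
exists (b' * b' * g) => n Nn /dvdnP[m mE].
have b'm : b' * b' <= m by move: Nn; rewrite mE leq_pmul2r.
have qb : b' <= m %/ b' by rewrite leq_divRL.
have rb : m %% b' <= m %/ b'.
  by apply: leq_trans qb; apply: ltnW; rewrite ltn_mod.
(* Dividing [m] by [b'] writes [n] as a combination of [b] and [b + g]; the bound [b' * b' <= m]
   keeps the first coefficient nonnegative. *)
have -> : n = (m %/ b' - m %% b') * b + m %% b' * (b + g).
  by rewrite mulnDr addnA -mulnDl subnK// mE b'E mulnA -mulnDl -divn_eq.
by apply: Dadd; apply: Dmul.
Qed.

(** * Weighted walks and their composition *)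

Section Walks.
Local Open Scope ring_scope.
Variables (R : realType) (S : Type).
Implicit Types (P Q : S -> S -> set R) (i j k l : S) (w : R).

(** An empty set of weights plays the role of -oo, so walks involve real arithmetic only. *)
Definition wone i j : set R := [set w | i = j /\ w = 0].

Definition wmul P Q i j : set R :=
  [set w | exists k x y, [/\ P i k x, Q k j y & w = x + y]].

(* [walk P n i j w]: some path of length [n] from [i] to [j] has weight [w],
   where [P i j] holds the weights of the arcs from [i] to [j]. *)
Definition walk P (n : nat) : S -> S -> set R := iter n (wmul P) wone.

Lemma walk0 P i : walk P 0 i i 0. Proof. by []. Qed.

Lemma walk1 P i j w : P i j w -> walk P 1 i j w.
Proof. by move=> Pw; exists j, w, 0; rewrite addr0. Qed.

Lemma walk1P P i j w : walk P 1 i j w -> P i j w.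
Proof. by move=> [k [x [y [Pkx [<- ->] ->]]]]; rewrite addr0. Qed.

Lemma walk_cat P m n i k j w1 w2 :
  walk P m i k w1 -> walk P n k j w2 -> walk P (m + n) i j (w1 + w2).
Proof.
elim: m i w1 => [|m IH] i w1 /=; first by move=> [-> ->]; rewrite add0r.
move=> [l [x [y [Pil lk ->]]]] kj; exists l, x, (y + w2); split=> //.
  exact: IH.
by rewrite addrA.
Qed.

(** [f] lists the nodes and [h] the accumulated weights. Having every segment at hand lets later
    proofs cut walks and delete pieces without a new induction. *)
Lemma walk_nodes P n i j w : walk P n i j w ->
  exists (f : nat -> S) (h : nat -> R),
    [/\ f 0 = i, f n = j, h 0 = 0, h n = w &
        forall s t, (s <= t <= n)%N ->
          walk P (t - s) (f s) (f t) (h t - h s)].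
Proof.
elim: n i w => [|n IH] i w.
  move=> [<- ->]; exists (fun=> i), (fun=> 0); split=> // s t st.
  have [-> ->] : s = 0 /\ t = 0 by lia.
  by rewrite subrr.
move=> [k [x [y [Pik /IH[f [h [f0 fn h0 hn fh]]] ->]]]].
exists (fun t => if t is t'.+1 then f t' else i).
exists (fun t => if t is t'.+1 then x + h t' else 0); split=> //.
  by rewrite hn.
move=> [|s] [|t] //.
- by rewrite subrr.
- move=> /= tn; rewrite subr0; exists k, x, (h t); split=> //.
  by have := fh 0%N t; rewrite f0 h0 subr0 subn0; apply; lia.
- move=> st; rewrite subSS opprD addrACA subrr add0r; apply: fh; lia.
Qed.

Lemma walk_split P m n i j w : walk P (m + n) i j w ->
  exists k w1 w2, [/\ walk P m i k w1, walk P n k j w2 & w = w1 + w2].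
Proof.
move=> /walk_nodes[f [h [f0 fn h0 hn fh]]].
exists (f m), (h m), (w - h m); split; last lra.
  by have := fh 0%N m; rewrite f0 h0 subr0 subn0; apply; lia.
by have := fh m (m + n)%N; rewrite fn hn addKn; apply; lia.
Qed.

Lemma walk_iter P n i w q : walk P n i i w -> walk P (q * n) i i (w *+ q).
Proof.
move=> ii; elim: q => [|q IH]; first by rewrite mul0n mulr0n; exact: walk0.
by rewrite mulSn mulrS; exact: (walk_cat ii IH).
Qed.

Lemma walk_mul P m n : walk (walk P m) n = walk P (n * m).
Proof.
elim: n => [//|n IH]; apply/funext => i; apply/funext => j.
rewrite mulSn [LHS]/= -/(walk _ _) IH; apply/seteqP; split=> w /=.
  by move=> [k [x [y [ik kj ->]]]]; apply: walk_cat kj.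
by move=> /walk_split[k [x [y [? ? ?]]]]; exists k, x, y.
Qed.

Definition zero_loops P k : set nat := [set n | walk P n k k 0].

Definition critical P k : Prop := exists2 n, (0 < n)%N & zero_loops P k n.

(** For the arcs of a normalized matrix, this is the cyclicity of the component of [k] in the
    critical graph. *)
Definition is_period P k (g : nat) : Prop :=
  [/\ (0 < g)%N, forall n, zero_loops P k n -> (g %| n)%N &
      exists N, forall n, (N <= n)%N -> (g %| n)%N -> zero_loops P k n].

End Walks.

(** * Periodicity of walks under a finite and tight Kleene star *)

Section Periodicity.
Local Open Scope ring_scope.
Variables (R : realType) (S : eqType) (P : S -> S -> set R) (V : S -> S -> R).
Implicit Types (i j k l c : S) (w u v beta : R).

(* [V] is the Kleene star of the matrix with arc weights [P], read off as the
   least upper bound of the weights of walks. *)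
Hypothesis P_fun : forall i j w u, P i j w -> P i j u -> w = u.
Hypothesis walk_le : forall n i j w, walk P n i j w -> w <= V i j.
Hypothesis V_lub : forall i j u,
  (forall n w, walk P n i j w -> w <= u) -> V i j <= u.
Hypothesis V_tight : forall i j beta,
  finite_set [set k | beta <= V i k + V k j].
Hypothesis connected : forall i j, exists n w, walk P n i j w.

(** The walk can precede every walk from [k] to [j]. Thus [V _ j] is a potential, whose differences
    bound weights. *)
Lemma walk_potential n i k j w : walk P n i k w -> w + V k j <= V i j.
Proof.
move=> ik; rewrite addrC -lerBrDr; apply: V_lub => m u kj.
by rewrite lerBrDr addrC; apply: walk_le (walk_cat ik kj).
Qed.

Lemma closed_walk_le0 n i w : walk P n i i w -> w <= 0.
Proof. by move=> ii; have := walk_potential i ii; rewrite gerDr. Qed.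

Lemma critical_period k : critical P k -> exists g, is_period P k g.
Proof.
move=> kc; apply: semigroup_gcd kc; first exact: walk0.
by move=> m n km kn; have := walk_cat km kn; rewrite addr0.
Qed.

(* Long walks in a fixed residue class cannot be forced below a constant: go
   through [c] and wait there on zero loops. *)
Lemma walk_lower_bound i j c g : is_period P c g ->
  exists (beta : R) (N : nat), forall n m w, (N <= n)%N -> walk P m i j w ->
    m = n %[mod g] -> exists2 w', beta <= w' & walk P n i j w'.
Proof.
move=> [g0 _ [Nc cN]].
(* [N] bounds both length and weight, so [Q r] persists as [N] grows and one [N] serves all
   residues. *)
pose Q (r : 'I_g) (N : nat) := forall n, (N <= n)%N -> n = r %[mod g] ->
  (exists m w, walk P m i j w /\ m = r %[mod g]) ->
  exists2 w', - N%:R <= w' & walk P n i j w'.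
have [N NQ] : exists N, forall (r : 'I_g) N', setT r -> (N <= N')%N -> Q r N'.
  apply: finite_set_eventually; first exact: finite_finset.
  move=> r _.
  have [[m [w [ij mr]]]|noij] :=
    pselect (exists m w, walk P m i j w /\ m = r %[mod g]); last first.
    by exists 0%N => N' _ n _ _ /noij.
  have [a [u ic]] := connected i c; have [b [v ci]] := connected c i.
  (* With [g - 1] further round trips between [i] and [c], the length [a + (b + L)] is
     [(a + b) * g + m], in the class of [m]. *)
  pose L := ((g.-1 * (a + b)) + m)%N.
  have cj : exists u', walk P (b + L) c j u'.
    have /(@walk_iter _ _ _ _ _ _ g.-1) ii := walk_cat ic ci.
    by eexists; apply: walk_cat ci (walk_cat ii ij).
  have [u' {}cj] := cj.
  exists (maxn (a + (b + L) + Nc) (Num.truncn `|u + u'|).+1) => N'.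
  rewrite geq_max => /andP[N'1 N'2] n nN' nr _; exists (u + u').
    rewrite lerNl (le_trans (ler_norm _))// normrN ltW//.
    by rewrite (lt_le_trans (truncnS_gt _))// ler_nat.
  have cc : zero_loops P c (n - (a + (b + L)))%N.
    apply: cN; first lia.
    have : (a + (b + L) = n %[mod g])%N.
      have -> : (a + (b + L) = (a + b) * g + m)%N.
        by rewrite -[in RHS](prednK g0) mulnS mulnC /L; lia.
      by rewrite modnMDl mr nr.
    by move=> /esym/eqP; rewrite eqn_mod_dvd//; lia.
  have := walk_cat ic (walk_cat cc cj); rewrite add0r.
  by congr (walk _ _ _ _ _); lia.
exists (- N%:R), N => n m w Nn ij mn.
have ng : (n %% g < g)%N by rewrite ltn_mod.
have [] // := @NQ (Ordinal ng) N I _ n Nn; rewrite /= ?modn_mod//.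
  by exists m, w.
by move=> w'; exists w'.
Qed.

Section IndexedNodes.
Variables (F : set S) (M : nat) (e : S -> nat).
Hypothesis e_lt : forall k, F k -> (e k < M)%N.
Hypothesis e_inj : forall k l, F k -> F l -> e k = e l -> k = l.

(** The [M * s + 1] times share at most [M * s] pairs of a node of [F] and a residue modulo [s]. *)
Lemma pigeonhole (s : nat) (f : nat -> S) : (0 < s)%N ->
  (forall t, (t <= M * s)%N -> F (f t)) ->
  exists t t', [/\ (t < t' <= M * s)%N, f t = f t' & t = t' %[mod s]].
Proof.
move=> s0 fF.
have lt_code (t : 'I_(M * s).+1) : (e (f t) * s + t %% s < M * s)%N.
  have /e_lt eM : F (f t) by apply: fF; rewrite -ltnS.
  have := ltn_pmod t s0; nia.
pose code t := Ordinal (lt_code t).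
have : ~~ injectiveb code.
  apply/injectiveP => /leq_card; rewrite !card_ord; lia.
move=> /injectivePn[t [t' tt' /(congr1 val) /= cE]].
have modE : (t %% s = t' %% s)%N.
  by have := congr1 (modn^~ s) cE; rewrite !modnMDl !modn_mod.
have fE : f t = f t'.
  apply: e_inj; [by apply: fF; rewrite -ltnS..|].
  by have := cE; rewrite modE => /addIn /eqP; rewrite eqn_pmul2r// => /eqP.
have := ltn_ord t; have := ltn_ord t'; rewrite !ltnS => t'M tM.
have [ltt'|lt't|] := ltngtP t t'; last first.
- by move=> /val_inj/eqP; rewrite (negPf tt').
- by exists t', t; rewrite lt't.
- by exists t, t'; rewrite ltt'.
Qed.

(* Removing closed subwalks of length divisible by [s]. *)
Lemma walk_shorten (s a : nat) k l w : (0 < s)%N ->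
  (forall m n x u v, walk P m k x u -> walk P n x l v -> w <= u + v -> F x) ->
  walk P a k l w ->
  exists a' w', [/\ (a' < M * s)%N, a' = a %[mod s], w <= w' &
                    walk P a' k l w'].
Proof.
(* The condition on [F] covers walks of every length and of weight at least [w], so it survives the
   deletion of a closed subwalk, which never lowers the weight. *)
move=> s0 inF; have [n] := ubnP a; elim: n a w inF => // n IH a w inF an kl.
have [aM|Ma] := ltnP a (M * s); first by exists a, w.
have [f [h [f0 fa h0 ha fh]]] := walk_nodes kl.
have fF t : (t <= M * s)%N -> F (f t).
  move=> tM; apply: (inF t (a - t)%N _ (h t) (w - h t)).
  - by have := fh 0%N t; rewrite f0 h0 subr0 subn0; apply; lia.
  - by rewrite -fa -ha; apply: fh; lia.
  - by rewrite addrC subrK.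
have [t [t' [tt' ft mt]]] := pigeonhole s0 fF.
have loop : walk P (t' - t) (f t) (f t) (h t' - h t).
  by rewrite {2}ft; apply: fh; lia.
have loop_le := closed_walk_le0 loop.
have head : walk P t k (f t) (h t).
  by have := fh 0%N t; rewrite f0 h0 subr0 subn0; apply; lia.
have tail : walk P (a - t') (f t) l (w - h t').
  by rewrite ft -fa -ha; apply: fh; lia.
have [||a' [w' [a'M a'E ww' kl']]] := IH _ _ _ _ (walk_cat head tail).
- by move=> m m' x u v ? ? ?; apply: (inF m m' x u v) => //; lra.
- lia.
exists a', w'; split=> //; last lra.
rewrite a'E; apply/eqP; rewrite eq_sym eqn_mod_dvd; last lia.
have -> : (a - (t + (a - t')) = t' - t)%N by lia.
by rewrite -eqn_mod_dvd; [apply/eqP|lia].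
Qed.

End IndexedNodes.

(* With potential [V _ j], the weight of a walk inside [F] is a potential
   difference minus the slacks of its arcs; a closed walk all of whose slacks
   vanish is critical, so outside the critical nodes every closed walk loses at
   least the least positive slack, which exists as [F] is finite. *)
Lemma noncritical_loop_gap j (F : set S) : finite_set F ->
  exists2 d : R, 0 < d & forall n k w, (0 < n)%N -> walk P n k k w ->
    ~ critical P k ->
    (forall m m' l u u', walk P m k l u -> walk P m' l k u' -> w = u + u' ->
       F l) ->
    w <= - d.
Proof.
move=> finF.
(* The least positive slack is replaced by the lower bound [1 / (N + 1)], with one [N] for the
   finitely many pairs of nodes of [F]. *)
pose Q (kl : S * S) n := forall x, P kl.1 kl.2 x ->
  0 < V kl.1 j - V kl.2 j - x -> n.+1%:R^-1 <= V kl.1 j - V kl.2 j - x.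
have [N NQ] : exists N, forall kl n, (F `*` F) kl -> (N <= n)%N -> Q kl n.
  apply: finite_set_eventually; first exact: finite_setX.
  move=> [k l] _; have [[x kl]|nokl] := pselect (exists x, P k l x); last first.
    by exists 0%N => n _ x kl; case: nokl; exists x.
  set y := V k j - V l j - x.
  exists (Num.truncn y^-1) => n nN x' /= /(P_fun kl) <-; rewrite -/y => y0.
  rewrite -[leRHS]invrK lef_pV2 ?posrE ?invr_gt0//.
  by rewrite ltW// (lt_le_trans (truncnS_gt _))// ler_nat.
exists N.+1%:R^-1 => [|n k w n0 kk knc inF]; first by rewrite invr_gt0.
have [f [h [f0 fn h0 hn fh]]] := walk_nodes kk.
have head t : (t <= n)%N -> walk P t k (f t) (h t).
  by move=> tn; have := fh 0%N t; rewrite f0 h0 subr0 subn0; apply; lia.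
have tail t : (t <= n)%N -> walk P (n - t) (f t) k (w - h t).
  by move=> tn; rewrite -fn -hn; apply: fh; lia.
have arc t : (t < n)%N -> walk P 1 (f t) (f t.+1) (h t.+1 - h t).
  by move=> tn; rewrite -(subSnn t); apply: fh; lia.
pose slack t := V (f t) j - V (f t.+1) j - (h t.+1 - h t).
have slack_ge0 t : (t < n)%N -> 0 <= slack t.
  by move=> /arc/(walk_potential j); rewrite /slack; lra.
have [[t [tn st]]|nost] := pselect (exists t, (t < n)%N /\ 0 < slack t).
  have Ff t' : (t' <= n)%N -> F (f t').
    by move=> t'n; apply: inF (head _ t'n) (tail _ t'n) _; lra.
  have /(_ (leqnn _) _ (walk1P (arc t tn)) st) /= :=
    NQ (f t, f t.+1) N (conj (Ff t (ltnW tn)) (Ff t.+1 tn)).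
  have := walk_potential j (head _ (ltnW tn)).
  have := walk_potential j (tail _ tn).
  by move: (_^-1) => d; lra.
(* No slack is positive, so weights are potential differences, and the closed walk has weight 0. *)
have hE t : (t <= n)%N -> V (f t) j + h t = V k j.
  elim: t => [|t IH] tn; first by rewrite f0 h0 addr0.
  rewrite -IH 1?ltnW//; have := slack_ge0 t tn.
  have : ~ 0 < slack t by move=> ?; apply: nost; exists t.
  rewrite /slack => /negP; rewrite -leNgt; lra.
case: knc; exists n => //; have := hE n (leqnn n).
by rewrite fn hn -[RHS]addr0 => /addrI w0; rewrite /zero_loops /= -w0.
Qed.

Lemma long_walk_critical i j beta : exists N, forall n w, (N <= n)%N ->
  beta <= w -> walk P n i j w ->
  exists k n1 n2 w1 w2, [/\ critical P k, walk P n1 i k w1, walk P n2 k j w2,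
    (n1 + n2 = n)%N & w1 + w2 = w].
Proof.
set F := [set k | beta <= V i k + V k j].
have finF : finite_set F by exact: V_tight.
have [M [e [eM e_inj]]] := finite_set_index finF.
have [d d0 dP] := noncritical_loop_gap j finF.
(* [K] losses of [d] bring [V i j] below [beta]. *)
pose K := (Num.truncn ((V i j - beta) / d)).+1.
exists (K * M)%N => n w Kn bw ij; apply: contrapT => noc.
have [f [h [f0 fn h0 hn fh]]] := walk_nodes ij.
have head t : (t <= n)%N -> walk P t i (f t) (h t).
  by move=> tn; have := fh 0%N t; rewrite f0 h0 subr0 subn0; apply; lia.
have tail t : (t <= n)%N -> walk P (n - t) (f t) j (w - h t).
  by move=> tn; rewrite -fn -hn; apply: fh; lia.
have Ff t : (t <= n)%N -> F (f t).
  move=> tn; have := walk_le (head t tn); have := walk_le (tail t tn).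
  by rewrite /F /=; lra.
(* [h t + V (f t) j] never increases along the walk and drops by at least [d] at the closed subwalk
   found in each block of [M] steps. *)
have drop L t : (L * M <= t <= n)%N -> h t + V (f t) j <= V i j - d *+ L.
  elim: L t => [|L IH] t tn.
    rewrite mulr0n subr0; apply: walk_potential (head _ _); lia.
  have [|s [s' [ss' fs _]]] :=
      @pigeonhole F M e eM e_inj 1 (fun t => f (L * M + t)%N) isT.
    by move=> s sM; apply: Ff; lia.
  set r := (L * M + s)%N in fs *; set r' := (L * M + s')%N in fs *.
  have rn : (r <= n)%N by lia.
  have r'n : (r' <= n)%N by lia.
  have loop : walk P (r' - r) (f r) (f r) (h r' - h r).
    by rewrite {2}fs; apply: fh; lia.
  have gap : h r' - h r <= - d.
    apply: dP loop _ _; first lia.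
      move=> rc; apply: noc; exists (f r), r, (n - r)%N, (h r), (w - h r).
      split; [by []|exact: head|exact: tail|lia|lra].
    (* Rerouting the loop at equal weight keeps the whole walk at weight at least [beta], so [l]
       lies in [F]. *)
    move=> m m' l u u' kl lk uE; have ltail := tail r' r'n; rewrite -fs in ltail.
    have := walk_le (walk_cat (head r rn) kl).
    by have := walk_le (walk_cat lk ltail); rewrite /F /=; lra.
  have : h t - h r' + V (f t) j <= V (f r') j.
    by apply: (walk_potential (n := (t - r')%N)); apply: fh; lia.
  have : h r + V (f r) j <= V i j - d *+ L by apply: IH; lia.
  rewrite -fs mulrS; lra.
have := drop K n; rewrite fn hn Kn leqnn => /(_ isT).
have := walk_le (walk0 P j).
have : (V i j - beta) / d < K%:R by rewrite truncnS_gt.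
rewrite ltr_pdivrMr// mulrC mulr_natr; lra.
Qed.

(* Moving the splitting node along a zero loop through [k] changes the two
   lengths to any prescribed residues with the right sum. *)
Lemma critical_rotate (s q q' a b : nat) i j k w1 w2 : (0 < s)%N ->
  critical P k -> walk P a i k w1 -> walk P b k j w2 ->
  (a + b = q + q' %[mod s])%N ->
  exists k' a' b' w1' w2', [/\ critical P k', walk P a' i k' w1',
    walk P b' k' j w2', w1' + w2' = w1 + w2 &
    (a' = q %[mod s])%N /\ (b' = q' %[mod s])%N].
Proof.
move=> s0 [l l0 kk] ik kj abq.
(* Here [a + t = a * s + q]. Below, [T] is a multiple of [l] (a zero loop exists), of [s] (residues
   are unchanged), and at least [t] (the loop can be cut there). *)
pose t := (q + a * s.-1)%N.
pose T := (t.+1 * s * l)%N.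
have tT : (t <= T)%N by rewrite /T; nia.
have kkT : walk P T k k 0 by have := walk_iter (t.+1 * s) kk; rewrite mul0rn.
have kkT' : walk P (t + (T - t)) k k 0 by rewrite subnKC.
have [k' [u [v [kk' k'k uv]]]] := walk_split kkT'.
have atq : (a + t = q %[mod s])%N.
  have -> : (a + t = a * s + q)%N by rewrite -[in RHS](prednK s0) mulnS /t; lia.
  exact: modnMDl.
exists k', (a + t)%N, (T - t + b)%N, (w1 + u), (v + w2).
split; [|exact: walk_cat ik kk'|exact: walk_cat k'k kj|lra|split=> //].
  exists (T - t + t)%N; first by rewrite subnK// /T; nia.
  by have := walk_cat k'k kk'; rewrite addrC -uv.
apply/eqP; rewrite -(eqn_modDl q) -modnDml -atq modnDml.
have -> : (a + t + (T - t + b) = t.+1 * l * s + (a + b))%N.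
  by rewrite /T in tT *; nia.
by rewrite modnMDl abq.
Qed.

(** Both inequalities of the explicit formula come from here: shortening and then waiting at [k]
    gives one, a critical node on a long walk followed by rotation the other. *)
Lemma critical_walks i j c (g : S -> nat) : critical P c ->
  (forall k, critical P k -> is_period P k (g k)) ->
  exists s N : nat, [/\ (0 < s)%N,
    forall m, (forall k, critical P k -> (g k %| m)%N) -> (s %| m)%N,
    forall n k a b w1 w2, (N <= n)%N -> critical P k -> walk P a i k w1 ->
      walk P b k j w2 -> (a + b = n %[mod s])%N ->
      exists2 w, w1 + w2 <= w & walk P n i j w &
    forall n q q' w, (N <= n)%N -> walk P n i j w ->
      (q + q' = n %[mod s])%N ->
      exists k a b w1 w2, [/\ critical P k, walk P a i k w1, walk P b k j w2,
        w <= w1 + w2 & (a = q %[mod s])%N /\ (b = q' %[mod s])%N]].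
Proof.
move=> crc gP.
have [beta [N1 lower]] := walk_lower_bound i j (gP c crc).
have [N2 upper] := long_walk_critical i j beta.
set F := [set k | beta <= V i k + V k j].
have finF : finite_set F by exact: V_tight.
have [M [e [eM e_inj]]] := finite_set_index finF.
(* Including [c] makes [g c] divide [s], so congruences modulo [s] suffice for [lower]. *)
have [||s [s0 sg smin]] := @finite_set_lcm _ ((F `|` [set c]) `&` critical P) g.
- by apply: finite_setIl; rewrite finite_setU; split.
- by move=> k [_ /gP[]].
have [N3 wait] : exists N, forall k n, (F `&` critical P) k -> (N <= n)%N ->
    (s %| n)%N -> zero_loops P k n.
  apply: finite_set_eventually; first exact: finite_setIl.
  move=> k [Fk kc]; have [_ _ [N NP]] := gP k kc.
  exists N => n Nn sn; apply: NP => //; apply: dvdn_trans sn; apply: sg.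
  by split=> //; left.
(* The two shortened walks take less than [M * s] steps each, leaving at least [N3] for waiting at
   [k]. *)
exists s, (maxn (maxn N1 N2) (M * s + M * s + N3)); split=> //.
- by move=> m mP; apply: smin => k [_ /mP].
- move=> n k a b w1 w2; rewrite !geq_max => /andP[/andP[nN1 _] nN3] kc ik kj abn.
  (* Below [beta] the node [k] may lie outside [F], but a walk through [c] is already heavy
     enough. *)
  have [w12|w12] := ltP (w1 + w2) beta.
    have [|w bw ijn] := lower n _ _ nN1 (walk_cat ik kj).
      have gs : (g c %| s)%N by apply: sg; split=> //; right.
      have /eqP := congr1 (modn^~ (g c)) abn.
      by rewrite !modn_dvdm// => /eqP.
    by exists w => //; lra.
  have Fk : F k.
    by have := walk_le ik; have := walk_le kj; rewrite /F /=; lra.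
  have [|a' [w1' [a'M a'E ww1 {}ik]]] := walk_shorten eM e_inj s0 _ ik.
    move=> m m' x u v ix xk uv; have := walk_le ix.
    by have := walk_le (walk_cat xk kj); rewrite /F /=; lra.
  have [|b' [w2' [b'M b'E ww2 {}kj]]] := walk_shorten eM e_inj s0 _ kj.
    move=> m m' x u v kx xj uv; have := walk_le xj.
    by have := walk_le (walk_cat ik kx); rewrite /F /=; lra.
  have abn' : (a' + b' <= n)%N by lia.
  have kk : zero_loops P k (n - (a' + b'))%N.
    apply: wait => //; first lia.
    by rewrite -eqn_mod_dvd// -abn -(modnDm a') a'E b'E modnDm.
  exists (w1' + (0 + w2')); first lra.
  by have := walk_cat ik (walk_cat kk kj); congr (walk _ _ _ _ _); lia.
- move=> n q q' w; rewrite !geq_max => /andP[/andP[nN1 nN2] _] ij qq'.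
  have [w' [ww' bw' ij']] : exists w', [/\ w <= w', beta <= w' & walk P n i j w'].
    have [wb|wb] := ltP w beta; last by exists w.
    have [w' bw' ij'] := lower n _ _ nN1 ij erefl.
    by exists w'; split=> //; lra.
  have [k [n1 [n2 [w1 [w2 [kc ik kj nE wE]]]]]] := upper n w' nN2 bw' ij'.
  have [|k' [a [b [u1 [u2 [? ? ? ? ?]]]]]] :=
    critical_rotate (q := q) (q' := q') s0 kc ik kj; first by rewrite nE.
  by exists k', a, b, u1, u2; split=> //; lra.
Qed.

End Periodicity.

Local Open Scope ereal_scope.

(** * Max-plus matrices as suprema of walk weights *)

Section ExtendedReals.
Variable R : realType.
Implicit Types (X Y : set R).

(** Empty sets are covered because -oo absorbs +oo. *)
Lemma ereal_sup_EFinD X Y :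
  ereal_sup (EFin @` X) + ereal_sup (EFin @` Y) =
  ereal_sup (EFin @` [set w | exists x y, [/\ X x, Y y & w = (x + y)%R]]).
Proof.
apply/eqP; rewrite eq_le; apply/andP; split; last first.
  apply: ge_ereal_sup => _ [_ [x [y [Xx Yy ->]]] <-]; rewrite EFinD.
  by apply: leeD; apply: ereal_sup_ubound; [exists x|exists y].
have [[x0 Xx0]|nX] := pselect (X !=set0); last first.
  have -> : X = set0 by apply/eqP/negPn/negP => /set0P.
  by rewrite image_set0 ereal_sup0 addNye leNye.
have [[y0 Yy0]|nY] := pselect (Y !=set0); last first.
  have -> : Y = set0 by apply/eqP/negPn/negP => /set0P.
  by rewrite image_set0 ereal_sup0 addeNy leNye.
set Z := [set w | _].
have Zle x y : X x -> Y y -> (x + y)%:E <= ereal_sup (EFin @` Z).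
  by move=> Xx Yy; apply: ereal_sup_ubound; exists (x + y)%R => //; exists x, y.
case: (ereal_sup (EFin @` Z)) Zle => [z| |] Zle; last first.
- by have := Zle _ _ Xx0 Yy0.
- exact: leey.
have Xle y : Y y -> ereal_sup (EFin @` X) <= (z - y)%:E.
  move=> Yy; apply: ge_ereal_sup => _ [x Xx <-].
  by rewrite lee_fin lerBrDr -lee_fin Zle.
have : x0%:E <= ereal_sup (EFin @` X) by apply: ereal_sup_ubound; exists x0.
case: (ereal_sup (EFin @` X)) Xle => [a| |] Xle // _; last first.
  by have := Xle _ Yy0.
rewrite -leeBrDl//; apply: ge_ereal_sup => _ [y Yy <-].
by have := Xle _ Yy; rewrite -EFinB !lee_fin; lra.
Qed.

Lemma ereal_sup_EFin_shift X (c : R) :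
  ereal_sup (EFin @` X) + c%:E = ereal_sup (EFin @` [set (x + c)%R | x in X]).
Proof.
rewrite -[c%:E]ereal_sup1 -image_set1 ereal_sup_EFinD; congr (ereal_sup (_ @` _)).
apply/seteqP; split=> w /=.
  by move=> [x [_ [Xx -> ->]]]; exists x.
by move=> [x Xx <-]; exists x, c.
Qed.

Variable S : Type.
Implicit Types (P Q : S -> S -> set R) (A : S -> S -> \bar R).

Definition sup_mx P i j : \bar R := ereal_sup (EFin @` P i j).

Lemma sup_mx_wone : sup_mx (@wone R S) = mpone.
Proof.
apply/funext => i; apply/funext => j; rewrite /sup_mx /mpone.
case: asboolP => [->|nij].
  have -> : wone j j = [set 0%R] :> set R by apply/seteqP; split=> w /= => [[]|].
  by rewrite image_set1 ereal_sup1.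
have -> : wone i j = set0 :> set R by apply/seteqP; split=> w /= => [[]|].
by rewrite image_set0 ereal_sup0.
Qed.

Lemma mpmul_sup P Q : mpmul (sup_mx P) (sup_mx Q) = sup_mx (wmul P Q).
Proof.
apply/funext => i; apply/funext => j; apply/eqP.
rewrite eq_le; apply/andP; split.
  apply: ge_ereal_sup => _ [k _ <-]; rewrite /sup_mx ereal_sup_EFinD.
  apply: ereal_sup_le => _ [w [x [y [Pik Qkj wE]]] <-].
  by exists w => //; exists k, x, y.
apply: ge_ereal_sup => _ [w [k [x [y [Pik Qkj ->]]]] <-].
apply: le_ereal_sup_tmp; exists (sup_mx P i k + sup_mx Q k j); first by exists k.
by rewrite EFinD; apply: leeD; apply: ereal_sup_ubound; [exists x|exists y].
Qed.

Lemma mpexp_sup P n : mpexp (sup_mx P) n = sup_mx (walk P n).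
Proof.
elim: n => [|n IH]; first by rewrite /mpexp /= -sup_mx_wone.
by rewrite /mpexp iterS -/(mpexp _ n) IH mpmul_sup.
Qed.

Lemma mpstar_sup P :
  mpstar (sup_mx P) = sup_mx (fun i j => [set w | exists n, walk P n i j w]).
Proof.
apply/funext => i; apply/funext => j; apply/eqP.
rewrite eq_le; apply/andP; split.
  apply: ge_ereal_sup => _ [n _ <-]; rewrite mpexp_sup.
  by apply: ereal_sup_le => _ [w wn <-]; exists w => //; exists n.
apply: ge_ereal_sup => _ [w [n wn] <-].
apply: le_ereal_sup_tmp; exists (mpexp (sup_mx P) n i j); first by exists n.
by rewrite mpexp_sup; apply: ereal_sup_ubound; exists w.
Qed.

(** This is how residues enter the formula: the lengths involved are those at least [q] and
    congruent to [q] modulo [s]. *)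
Lemma mpmul_mpexp_mpstar P q s :
  mpmul (mpexp (sup_mx P) q) (mpstar (mpexp (sup_mx P) s)) =
  sup_mx (fun i j => [set w | exists m, walk P (q + m * s) i j w]).
Proof.
rewrite !mpexp_sup mpstar_sup mpmul_sup; congr sup_mx.
apply/funext => i; apply/funext => j; apply/seteqP; split=> w /=.
  move=> [k [x [y [ik [m]]]]]; rewrite walk_mul => kj ->.
  by exists m; exact: walk_cat ik kj.
move=> [m ij]; have [k [x [y [ik kj ->]]]] := walk_split ij.
by exists k, x, y; split=> //; exists m; rewrite walk_mul.
Qed.

(** * Graph paths, critical nodes and cyclicity *)

Definition arcs A i j : set R := [set w | A i j = w%:E].

Lemma sup_mx_arcs A : (forall i j, A i j != +oo) -> sup_mx (arcs A) = A.
Proof.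
move=> Aoo; apply/funext => i; apply/funext => j; rewrite /sup_mx /arcs.
have := Aoo i j; case: (A i j) => [a| |]// _.
  have -> : [set w | a%:E = w%:E] = [set a].
    by apply/seteqP; split=> w /= => [[->]|->].
  by rewrite image_set1 ereal_sup1.
have -> : [set w : R | -oo = w%:E] = set0 by apply/seteqP; split=> w.
by rewrite image_set0 ereal_sup0.
Qed.

Lemma path_nodes A x (p : seq S) : (forall i j, A i j != +oo) ->
  path (Defs.arc (graph A)) x p ->
  exists h : nat -> R, [/\ h 0%N = 0%R, weight A x p = (h (size p))%:E &
    forall s t, (s <= t <= size p)%N ->
      walk (arcs A) (t - s) (nth x (x :: p) s) (nth x (x :: p) t) (h t - h s)%R].
Proof.
move=> Aoo /(pathP x) xp.
pose a t := A (nth x (x :: p) t) (nth x p t).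
have aE t : (t < size p)%N -> a t = (fine (a t))%:E.
  by move=> tp; rewrite fineK// fin_numE Aoo andbT; exact: xp.
exists (fun t => \sum_(m < t) fine (a m))%R; split.
- by rewrite big_ord0.
- by rewrite -sumEFin; apply: eq_bigr => t _; exact: aE.
- move=> s t /andP[st tp].
  elim: t st tp => [|t IH]; first by rewrite leqn0 => /eqP -> _; rewrite subrr.
  rewrite leq_eqVlt => /orP[/eqP -> _|st tp]; first by rewrite subnn subrr.
  rewrite subSn// -addn1 big_ord_recr/= addrAC.
  by apply: walk_cat; [apply: IH => //; exact: ltnW|apply: walk1; exact: aE].
Qed.

Lemma walk_path A n x y w : walk (arcs A) n x y w ->
  exists p, [/\ size p = n, path (Defs.arc (graph A)) x p, last x p = y &
                weight A x p = w%:E].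
Proof.
move=> xy; have [f [h [f0 fn h0 hn fh]]] := walk_nodes xy.
have arc_f t : (t < n)%N -> A (f t) (f t.+1) = (h t.+1 - h t)%:E.
  by move=> tn; apply: (@walk1P _ _ (arcs A)); rewrite -(subSnn t); apply: fh; lia.
pose p := mkseq (fun t => f t.+1) n.
have sp : size p = n by exact: size_mkseq.
have nth_p t : (t < n)%N -> nth x p t = f t.+1 by move=> tn; rewrite nth_mkseq.
have nth_xp t : (t <= n)%N -> nth x (x :: p) t = f t.
  by case: t => [|t] tn; [rewrite f0|exact: nth_p].
exists p; split=> //.
- by apply/(pathP x) => t; rewrite sp => tn /=; rewrite nth_xp 1?ltnW// nth_p// arc_f.
- by rewrite (last_nth x) sp nth_xp.
- rewrite /weight sp (eq_bigr (fun t : 'I_n => (h t.+1 - h t)%:E)); last first.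
    by move=> t _; rewrite nth_xp 1?ltnW// nth_p// arc_f.
  rewrite sumEFin -(big_mkord xpredT (fun t => h t.+1 - h t)%R) telescope_sumr//.
  by rewrite h0 hn subr0.
Qed.

Lemma walk_normalized A r n i j w : rho A = r%:E ->
  walk (arcs (normalized A)) n i j w <-> walk (arcs A) n i j (w + n%:R * r)%R.
Proof.
move=> Ar; elim: n i w => [|n IH] i w /=.
  by rewrite mul0r addr0.
have arcE k x : arcs (normalized A) i k x <-> arcs A i k (x + r)%R.
  rewrite /arcs /normalized /= Ar; case: (A i k) => [a| |] //=.
  by split=> [[<-]|[->]]; congr EFin; lra.
split=> [[k [x [y [/arcE ik /IH kj ->]]]]|[k [x [y [ik kj wE]]]]].
  exists k, (x + r)%R, (y + n%:R * r)%R; split=> //.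
  by rewrite -addn1 natrD; lra.
exists k, (x - r)%R, (y - n%:R * r)%R; split.
- by apply/arcE; rewrite subrK.
- by apply/IH; rewrite subrK.
- by move: wE; rewrite -addn1 natrD; lra.
Qed.

(** A critical circuit restarted at [k] is a zero loop after normalization; conversely, a zero loop
    of positive length has mean [r] in [A]. *)
Lemma critical_nodesP A r k : (forall i j, A i j != +oo) -> rho A = r%:E ->
  critical_nodes A k <-> critical (arcs (normalized A)) k.
Proof.
move=> Aoo Ar; split.
  move=> [x [p [[[[_ xp] p0 lastp] mean] [t tp tk]]]].
  have [h [h0 wE hw]] := path_nodes Aoo xp.
  exists (size p) => //; rewrite /zero_loops /=; apply/(walk_normalized _ _ _ _ Ar).
  have kx : walk (arcs A) (size p - t) k x (h (size p) - h t)%R.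
    by have := hw t (size p); rewrite tk -last_nth lastp tp leqnn; apply.
  have xk : walk (arcs A) t x k (h t).
    by have := hw 0%N t; rewrite tk h0 subr0 subn0 tp; apply.
  have := walk_cat kx xk; rewrite subnK//; congr (walk _ _ _ _ _).
  move: mean; rewrite /mean_weight wE Ar -EFinM => -[<-].
  by rewrite add0r mulrCA mulfV ?pnatr_eq0 -?lt0n// mulr1; lra.
move=> [n n0 /(walk_normalized _ _ _ _ Ar)]; rewrite add0r.
move=> kk; have [p [sp xp lastp wE]] := walk_path kk.
exists k, p; split; last by exists 0%N.
split; first by split; rewrite ?sp.
rewrite /mean_weight wE Ar sp -EFinM; congr EFin.
by rewrite mulrAC mulfV ?mul1r// pnatr_eq0 -lt0n.
Qed.

(** Each critical arc lies on a circuit of normalized weight 0, whose remainder leads back with the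
    opposite weight. *)
Lemma critical_path_return A r x p :
  (forall i j, A i j != +oo) -> rho A = r%:E ->
  path (Defs.arc (critical_graph A)) x p ->
  exists w n, walk (arcs (normalized A)) (size p) x (last x p) w /\
              walk (arcs (normalized A)) n (last x p) x (- w)%R.
Proof.
move=> Aoo Ar; elim: p x => [|y p IH] x /=.
  by exists 0%R, 0%N; rewrite oppr0.
move=> /andP[/asboolP[z [c [[[[_ zc] c0 lastc] mean] [t [tc tx ty]]]]] /IH].
move=> [w [n [yw wy]]].
have [h [h0 wE hw]] := path_nodes Aoo zc.
have wE' : (h (size c) = (size c)%:R * r)%R.
  move: mean; rewrite /mean_weight wE Ar -EFinM => -[<-].
  by rewrite mulrCA mulfV ?pnatr_eq0 -?lt0n// mulr1.
have xy : walk (arcs (normalized A)) 1 x y (h t.+1 - h t - r)%R.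
  apply/(walk_normalized _ _ _ _ Ar); have := hw t t.+1; rewrite leqnSn tc.
  by rewrite subSnn tx [nth _ _ _]/= ty => /(_ isT); congr (walk _ _ _ _ _); lra.
have yx : walk (arcs (normalized A)) (size c - t.+1 + t) y x
    (- (h t.+1 - h t - r))%R.
  apply/(walk_normalized _ _ _ _ Ar).
  have yz : walk (arcs A) (size c - t.+1) y z (h (size c) - h t.+1)%R.
    by have := hw t.+1 (size c); rewrite /= ty -last_nth lastc tc leqnn; apply.
  have zx : walk (arcs A) t z x (h t).
    by have := hw 0%N t; rewrite tx h0 subr0 subn0 (ltnW tc); apply.
  have := walk_cat yz zx; congr (walk _ _ _ _ _); rewrite wE'.
  have -> : ((size c)%:R = (size c - t.+1 + t)%:R + 1 :> R)%R.
    by rewrite natr1; congr (_%:R)%R; lia.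
  by lra.
exists (h t.+1 - h t - r + w)%R, (n + (size c - t.+1 + t))%N; split.
  exact: walk_cat xy yw.
by rewrite opprD addrC; exact: walk_cat wy yx.
Qed.

Lemma normalized_closed_walk_le0 A r n i w :
  (forall i j, A i j != +oo) -> rho A = r%:E ->
  walk (arcs (normalized A)) n i i w -> (w <= 0)%R.
Proof.
move=> Aoo Ar; case: n => [[_ ->]//|n /(walk_normalized _ _ _ _ Ar) ii].
have [p [sp ip lastp wE]] := walk_path ii.
have : mean_weight A i p <= rho A.
  by apply: ereal_sup_ubound; exists i, p; split=> //; split; rewrite ?sp.
rewrite /mean_weight wE Ar sp -EFinM lee_fin ler_pdivrMr ?ltr0n//.
by rewrite mulrC gerDr.
Qed.

(* Every circuit [p] of the strongly connected component of [k] is joined to [k]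
   by critical arcs there and back, so [g] divides the lengths of that closed
   walk with and without [p]. *)
Lemma period_dvd_sigma A r k g s :
  (forall i j, A i j != +oo) -> rho A = r%:E ->
  critical_nodes A k -> is_period (arcs (normalized A)) k g ->
  sigma A = Some s -> (g %| s)%N.
Proof.
move=> Aoo Ar kc [_ gdvd _].
have closed_le0 := normalized_closed_walk_le0 Aoo Ar.
set G := critical_graph A.
(* The loop and its return have opposite weights, both nonpositive, hence both 0. *)
have loopP p : path (Defs.arc G) k p -> last k p = k -> (g %| size p)%N.
  move=> kp lastp; apply: gdvd; rewrite /zero_loops /=.
  have [w [n [w1 w2]]] := critical_path_return Aoo Ar kp.
  rewrite lastp in w1 w2; have := closed_le0 _ _ _ w1; have := closed_le0 _ _ _ w2.
  rewrite oppr_le0 => w_ge0 w_le0.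
  by have -> : 0%R = w by apply/eqP; rewrite eq_le w_ge0 w_le0.
have circuitP x p : connects G x k -> connects G k x -> path (Defs.arc G) x p ->
    last x p = x -> (g %| size p)%N.
  move=> [p1 [_ xk] lastp1] [p2 [_ kx] lastp2] xp lastp.
  have := loopP (p2 ++ p1); rewrite cat_path last_cat lastp2 kx xk => /(_ isT lastp1).
  have := loopP (p2 ++ p ++ p1).
  rewrite !cat_path !last_cat lastp2 lastp kx xp xk => /(_ isT lastp1).
  by rewrite !size_cat addnCA => + dvd21; rewrite dvdn_addl.
rewrite /sigma /cyclicity -/G; case: asboolP => [sc [<-]|_ /lcm_set_someP[_ [lcmP _]]].
  apply: (proj2 (gcd_setP _)) => _ [x [p [[[Gx xp] p0 lastp] <-]]].
  by apply: (circuitP x) => //; apply: sc.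
apply: dvdn_trans (lcmP (sc_cyclicity (induced G (component G k))) _); last by exists k.
apply: (proj2 (gcd_setP _)) => _ [x [p [[[[_ [kx xk]] xp] p0 lastp] <-]]].
apply: (circuitP x) => //; apply: sub_path xp => y z /=.
by move=> /and3P[].
Qed.

(** * Transfer to the matrix [A] and the explicit formula *)

Lemma irreducible_walk A r i j :
  (forall i j, A i j != +oo) -> rho A = r%:E -> irreducible A ->
  exists n w, walk (arcs (normalized A)) n i j w.
Proof.
move=> Aoo Ar /(_ i j I I)[p [_ ip] lastp].
have [h [h0 _ hw]] := path_nodes Aoo ip.
exists (size p), (h (size p) - (size p)%:R * r)%R.
apply/(walk_normalized _ _ _ _ Ar); rewrite subrK.
by have := hw 0%N (size p); rewrite -last_nth lastp h0 subr0 subn0 leqnn; apply.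
Qed.

Lemma mpexp_normalized A r n i j : (forall i j, A i j != +oo) -> rho A = r%:E ->
  (forall i j, normalized A i j != +oo) ->
  mpexp A n i j = mpexp (normalized A) n i j + (n%:R * r)%:E.
Proof.
move=> Aoo Ar Boo; rewrite -{1}(sup_mx_arcs Aoo) -(sup_mx_arcs Boo) !mpexp_sup.
rewrite /sup_mx ereal_sup_EFin_shift; congr (ereal_sup (_ @` _)).
apply/seteqP; split=> w /=.
  move=> wA; exists (w - n%:R * r)%R; last by rewrite subrK.
  by apply/(walk_normalized _ _ _ _ Ar); rewrite subrK.
by move=> [u /(walk_normalized _ _ _ _ Ar) uA <-].
Qed.

End ExtendedReals.

Lemma critical_walk_formula (R : realType) (S : eqType) (P : S -> S -> set R)
    (V : S -> S -> R) i j :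
  (forall i j w u, P i j w -> P i j u -> w = u) ->
  (forall i j, mpstar (sup_mx P) i j = (V i j)%:E) ->
  property_T (sup_mx P) ->
  (forall i j, exists n w, walk P n i j w) ->
  (exists c, critical P c) ->
  exists s N : nat, [/\ (0 < s)%N,
    forall m, (forall k g, critical P k -> is_period P k g -> (g %| m)%N) ->
      (s %| m)%N &
    forall n q q', (N <= n)%N -> (q < s)%N -> (q' < s)%N ->
      (q + q' = n %[mod s])%N ->
      mpexp (sup_mx P) n i j =
      ereal_sup [set mpmul (mpexp (sup_mx P) q)
                           (mpstar (mpexp (sup_mx P) s)) i k +
                     mpmul (mpexp (sup_mx P) q')
                           (mpstar (mpexp (sup_mx P) s)) k j
                | k in critical P]].
Proof.
move=> P_fun VE PT conn [c crc].
have walk_le n k l w : walk P n k l w -> (w <= V k l)%R.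
  move=> kl; rewrite -lee_fin -VE mpstar_sup.
  by apply: ereal_sup_ubound; exists w => //; exists n.
have V_lub k l u : (forall n w, walk P n k l w -> (w <= u)%R) -> (V k l <= u)%R.
  move=> ku; rewrite -lee_fin -VE mpstar_sup.
  by apply: ge_ereal_sup => _ [w [n kl] <-]; rewrite lee_fin; apply: ku kl.
have V_tight k l beta : finite_set [set x | beta <= V k x + V x l]%R.
  have [_ /(_ beta)] := PT l k; congr (finite_set _); apply/seteqP.
  by split=> x /=; rewrite !VE -EFinD lee_fin.
have [g gP] : exists g : S -> nat, forall k, critical P k -> is_period P k (g k).
  have /choice[g gP] : forall k, exists g, critical P k -> is_period P k g.
    move=> k; have [kc|nkc] := pselect (critical P k); last by exists 0%N.
    by have [g gP] := critical_period kc; exists g.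
  by exists g.
have [s [N [s0 smin lower upper]]] :=
  critical_walks P_fun walk_le V_lub V_tight conn i j crc gP.
exists s, N; split=> // [m mP|n q q' Nn qs q's qq'].
  by apply: smin => k kc; apply: mP kc (gP k kc).
apply/eqP; rewrite eq_le; apply/andP; split.
  rewrite mpexp_sup; apply: ge_ereal_sup => _ [w ij <-].
  have [k [a [b [w1 [w2 [kc ik kj ww [aq bq]]]]]]] := upper n q q' w Nn ij qq'.
  (* As [q0 < s], a length congruent to [q0] is [q0] plus a multiple of [s]. *)
  have modE a' q0 : (q0 < s)%N -> (a' = q0 %[mod s])%N ->
      a' = (q0 + a' %/ s * s)%N.
    by move=> q0s aE; rewrite {1}(divn_eq a' s) aE modn_small// addnC.
  apply: le_ereal_sup_tmp; eexists; first by exists k; [exact: kc|reflexivity].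
  apply: (@le_trans _ _ (w1%:E + w2%:E)); first by rewrite -EFinD lee_fin.
  rewrite !mpmul_mpexp_mpstar; apply: leeD; apply: ereal_sup_ubound.
    by exists w1 => //; exists (a %/ s)%N; rewrite -modE.
  by exists w2 => //; exists (b %/ s)%N; rewrite -modE.
apply: ge_ereal_sup => _ [k kc <-].
rewrite !mpmul_mpexp_mpstar /sup_mx ereal_sup_EFinD.
apply: ge_ereal_sup => _ [_ [w1 [w2 [[a ik] [b kj] ->]]] <-].
have [|w ww ij] := lower n k _ _ w1 w2 Nn kc ik kj.
  by rewrite addnACA -mulnDl addnC modnMDl.
rewrite mpexp_sup; apply: le_ereal_sup_tmp; exists w%:E; last by rewrite lee_fin.
by exists w.
Qed.

Theorem theorem7p4 (R : realType) (S : Type) (A : S -> S -> \bar R)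
  (S_infinite : infinite_set [set: S])
  (A_neq_pinfty : forall i j, A i j != +oo)
  (rho_fin : rho A \is a fin_num)
  (A_irreducible : irreducible A)
  (A_property_T : property_T (normalized A))
  (critical_nonempty : critical_nodes A !=set0) :
  forall i j : S, exists sij nij : nat,
    [/\ (0 < sij)%N,
        forall n, (nij <= n)%N ->
          mpexp A (n + sij) i j = sij%:R%:E * rho A + mpexp A n i j,
        forall n, (nij <= n)%N ->
          forall q q', (q < sij)%N -> (q' < sij)%N ->
            (q + q' = n %[mod sij])%N ->
            mpexp (normalized A) n i j =
            ereal_sup
              [set mpmul (mpexp (normalized A) q)
                         (mpstar (mpexp (normalized A) sij)) i k +
                   mpmul (mpexp (normalized A) q')
                         (mpstar (mpexp (normalized A) sij)) k j
              | k in critical_nodes A] &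
        forall s, sigma A = Some s -> (sij %| s)%N].
Proof.
move=> i j; have [r Ar] : exists r, rho A = r%:E.
  by exists (fine (rho A)); rewrite fineK.
set B := normalized A in A_property_T *; pose P := arcs B.
have Boo k l : B k l != +oo.
  by rewrite /B /normalized Ar; have := A_neq_pinfty k l; case: (A k l).
have BE : sup_mx P = B := sup_mx_arcs Boo.
have conn k l := irreducible_walk k l A_neq_pinfty Ar A_irreducible.
(* Irreducibility excludes -oo. Property (T) at the intermediate node [l] excludes +oo, since
   [mpstar B l l] is not -oo. *)
have starE k l : mpstar B k l = (fine (mpstar B k l))%:E.
  have gt_noo x y : -oo < mpstar B x y.
    have [n [w xy]] := conn x y.
    rewrite (lt_le_trans (ltNyr w))// -BE mpstar_sup.
    by apply: ereal_sup_ubound; exists w => //; exists n.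
  rewrite fineK// fin_numElt gt_noo/= ltey.
  have [/(_ l) + _] := A_property_T l k; apply: contra => /eqP ->.
  by rewrite addye// gt_eqF// gt_noo.
have critE : critical_nodes A = critical P.
  by apply/seteqP; split=> k /(critical_nodesP _ A_neq_pinfty Ar).
have PT : property_T (sup_mx P) by rewrite BE.
have [|||s [N [s0 smin formula]]] :=
  @critical_walk_formula R {classic S} P (fun k l => fine (mpstar B k l)) i j
    _ _ PT conn _.
- by move=> k l w u; rewrite /P /arcs /= => -> [].
- by move=> k l; rewrite BE; exact: starE.
- by case: critical_nonempty => c; rewrite critE; exists c.
rewrite BE in formula; exists s, N; split=> //.
(* Periodicity follows from the formula: with [q = n %% s] and [q' = 0], the right-hand sides for
   [n] and [n + s] coincide. *)
- move=> n Nn; rewrite !(mpexp_normalized _ _ _ A_neq_pinfty Ar Boo) -/B.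
  have ns : (n %% s < s)%N by rewrite ltn_mod.
  have nE m : (m = n %[mod s])%N -> (n %% s + 0 = m %[mod s])%N.
    by move=> ->; rewrite addn0 modn_mod.
  rewrite (formula n (n %% s)%N 0%N)//; last exact: nE.
  rewrite (formula (n + s)%N (n %% s)%N 0%N)//; last 2 first.
  - exact: leq_trans Nn (leq_addr _ _).
  - by apply: nE; rewrite modnDr.
  by rewrite Ar -EFinM addeCA -EFinD -mulrDl -natrD addnC.
- by move=> n Nn q q' qs q's qq'; rewrite critE; exact: formula.
(* Every period of a critical node divides [t], and [s] divides each common multiple of these
   periods. *)
- move=> t tE; apply: smin => k g kc kg.
  by apply: (period_dvd_sigma A_neq_pinfty Ar _ kg tE); rewrite critE.
Qed.
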